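(* Let $n,a,k\ge 1$ be integers and let $\vec p=(p_1,\dots,p_a)$ be a probability vector. Let $P_{n,a;\vec p}$ be the biased $a$-shuffle measure on the symmetric group $S_n$, let $P_{n,a;\vec p}^{*k}$ be its $k$-fold convolution, and let $U$ be the uniform distribution on $S_n$. Then $$\| P_{n,a;\vec p}^{*k}-U\| \le \binom{n}{2}\,\left[p_1^2+\cdots+p_a^2\right]^k .$$
   Context: Probability vector: real $p_i\ge 0$ with $\sum_{i=1}^a p_i=1$. Descents: $\pi\in S_n$ has a descent at position $i$ ($1\le i\le n-1$) if $\pi(i)>\pi(i+1)$; by convention every $\pi\in S_n$ also has a descent at position $n$. The descent set of $\pi$ is the set of positions at which it has a descent. The measure $P_{n,a;\vec p}$ on $S_n$ (biased riffle shuffle): first choose $(b_1,\dots,b_a)$, $b_i\ge 0$, $b_1+\cdots+b_a=n$, with probability $\binom{n}{b_1\cdots b_a}\prod_{i=1}^a p_i^{b_i}$; then choose uniformly one of the $\binom{n}{b_1\cdots b_a}$ permutations $\pi\in S_n$ such that the descent set of $\pi^{-1}$ is contained in $\{b_1,b_1+b_2,\dots,b_1+\cdots+b_a=n\}$. $P^{*k}$ is the $k$-fold convolution of $P$, i.e. the law of a product of $k$ independent permutations each with law $P$. The total variation distance is $\|P_1-P_2\|=\frac12\sum_{x\in S_n}|P_1(x)-P_2(x)|$. *)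

(* Defs.v *)
From mathcomp Require Import all_boot all_order all_algebra all_fingroup.

Set Implicit Arguments.
Unset Strict Implicit.
Unset Printing Implicit Defensive.

Import Order.TTheory GRing.Theory Num.Theory.
Local Open Scope ring_scope.

(* Positions are numbered 1, ..., n, as elements of 'I_n.+1 (the value 0 is
   never a descent): position i carries the entry pi x with x.+1 = i, and
   position i.+1 the entry pi y with y = i.  Position n is a descent by
   convention. *)
Definition descent_set (n : nat) (pi : 'S_n) : {set 'I_n.+1} :=
  [set i : 'I_n.+1 |
     ((0 < n)%N && (i == n :> nat)) ||
     [exists x : 'I_n, [exists y : 'I_n,
        [&& x.+1 == i, y == i :> nat & (pi y < pi x)%N]]]].

(* Pile sizes (b_1, ..., b_a) with sum n; each b_i is at most n. *)
Definition pile_sizes (n a : nat) : {set {ffun 'I_a -> 'I_n.+1}} :=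
  [set b : {ffun 'I_a -> 'I_n.+1} | (\sum_(i < a) b i)%N == n].

Definition cut_positions (n a : nat) (b : {ffun 'I_a -> 'I_n.+1}) :
    {set 'I_n.+1} :=
  [set s : 'I_n.+1 | [exists j : 'I_a,
     s == (\sum_(i < a | (i <= j)%N) b i)%N :> nat]].

Definition shuffles (n a : nat) (b : {ffun 'I_a -> 'I_n.+1}) : {set 'S_n} :=
  [set pi : 'S_n | descent_set (pi^-1)%g \subset cut_positions b].

Definition multinomial (R : realFieldType) (n a : nat)
    (b : {ffun 'I_a -> 'I_n.+1}) : R :=
  (n`!)%:R / \prod_(i < a) ((b i)`!)%:R.

Definition unif_on (R : realFieldType) (T : finType) (A : {set T}) (x : T) : R :=
  if x \in A then #|A|%:R^-1 else 0.

Definition biased_shuffle (R : realFieldType) (n a : nat) (p : 'I_a -> R)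
    (pi : 'S_n) : R :=
  \sum_(b in pile_sizes n a)
     (multinomial R b * \prod_(i < a) p i ^+ b i) * unif_on R (shuffles b) pi.

(* Law of a product of k independent elements of law P.  The factors are
   identically distributed, so the law does not depend on the order in which
   permutations are composed. *)
Definition conv_pow (R : realFieldType) (gT : finGroupType) (P : gT -> R)
    (k : nat) (x : gT) : R :=
  \sum_(s : {ffun 'I_k -> gT} | (\prod_(i < k) s i)%g == x) \prod_(i < k) P (s i).

Definition tv_dist (R : realFieldType) (T : finType) (P Q : T -> R) : R :=
  2^-1 * \sum_(x : T) `|P x - Q x|.

(* Main.v *)
(** Give each of the n cards an independent random label of law p and sort the
    cards stably by label.  The permutation [std K] that sends a card to its
    final position has law P_{n,a;p}: the words K with pile sizes b are in
    bijection, through [std], with the permutations whose inverse has its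
    descents among the partial sums of b.  Shuffling by labels in T1 and then
    by labels in T2 is the same as a single shuffle by labels in T2 x T1,
    ordered lexicographically, with the product law; hence P^{*k} is the shuffle
    law of some q with sum q^2 = (sum p^2)^k.  Given that the n labels are
    distinct, the permutation is uniform, so the total variation distance is at
    most the probability that two labels collide, and a union bound over the
    pairs of cards concludes. *)
Require Import Defs.
From mathcomp Require Import all_boot all_order all_algebra all_fingroup.

Set Implicit Arguments.
Unset Strict Implicit.
Unset Printing Implicit Defensive.

Import Order.TTheory GRing.Theory Num.Theory.
Local Open Scope ring_scope.

(** * Stable sorting of labelled cards and its permutation *)

Section Standardization.
Variables (d : Order.disp_t) (T : finOrderType d) (n : nat).
Implicit Types (K : {ffun 'I_n -> T}) (x y z : 'I_n) (s : 'S_n).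

Definition lexlt K x y :=
  (K x < K y)%O || (K x == K y) && (x < y)%N.

Lemma lexlt_irr K x : lexlt K x x = false.
Proof. by rewrite /lexlt ltxx ltnn andbF. Qed.

Lemma lexlt_trans K : transitive (lexlt K).
Proof.
rewrite /lexlt => y x z /orP[xy|/andP[/eqP -> xy]] /orP[yz|/andP[/eqP <- yz]].
- by rewrite (lt_trans xy yz).
- by rewrite xy.
- by rewrite yz.
- by rewrite eqxx (ltn_trans xy yz) orbT.
Qed.

Lemma lexlt_total K x y : x != y -> lexlt K x y || lexlt K y x.
Proof.
rewrite /lexlt -val_eqE /= neq_ltn.
by case: (ltgtP (K x) (K y)) => //= _ ->.
Qed.

Definition rank K x : nat := #|[set y | lexlt K y x]|.

Lemma rank_lt K x y : lexlt K x y -> (rank K x < rank K y)%N.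
Proof.
move=> xy; apply/proper_card/properP; split.
  by apply/subsetP => z; rewrite !inE => /lexlt_trans; apply.
by exists x; rewrite !inE ?lexlt_irr.
Qed.

Lemma rank_ltn K x : (rank K x < n)%N.
Proof.
rewrite -[n in (_ < n)%N]card_ord -cardsT; apply/proper_card/properP; split => //.
by exists x; rewrite !inE ?lexlt_irr.
Qed.

Lemma rank_ord_inj K : injective (fun x => Ordinal (rank_ltn K x)).
Proof.
move=> x y [] eq_rank; apply/eqP/negP => /negP /(lexlt_total K).
by case/orP => /rank_lt; rewrite eq_rank ltnn.
Qed.

Definition std K : 'S_n := perm (@rank_ord_inj K).

Lemma std_lt K x y : (std K x < std K y)%N = lexlt K x y.
Proof.
rewrite !permE /=; apply/idP/idP => [lt_xy|/rank_lt //].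
have [eq_xy|] := eqVneq x y; first by rewrite eq_xy ltnn in lt_xy.
by case/(lexlt_total K)/orP => // /rank_lt; rewrite ltnNge (ltnW lt_xy).
Qed.

(** Recovers a value of a permutation as a cardinality: with [m := s x] it says that [s x] counts
    the cards placed before [x]. *)
Lemma card_perm_lt s (m : nat) : (m <= n)%N -> #|[set y | (s y < m)%N]| = m.
Proof.
move=> le_mn; transitivity #|[set y : 'I_n | (y < m)%N]|.
  rewrite -[RHS](card_preimset _ (@perm_inj _ s)).
  by apply: eq_card => y; rewrite !inE.
by rewrite -sum1dep_card (big_ord_narrow le_mn) sum1_card card_ord.
Qed.

(** One direction suffices because [lexlt K] is total: monotonicity then becomes an equivalence, so
    [s] and [std K] put the same cards before each [x], and these counts are their values. *)
Lemma std_eqP K s :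
  reflect (forall x y, lexlt K x y -> (s x < s y)%N) (std K == s).
Proof.
apply: (iffP eqP) => [<- x y|sP]; first by rewrite std_lt.
have lt_s x y : (s x < s y)%N = lexlt K x y.
  apply/idP/idP => [lt_xy|/sP //].
  have [eq_xy|] := eqVneq x y; first by rewrite eq_xy ltnn in lt_xy.
  by case/(lexlt_total K)/orP => // /sP; rewrite ltnNge (ltnW lt_xy).
apply/permP => x; apply/val_inj; rewrite /= -[LHS](card_perm_lt (std K)) 1?ltnW //.
rewrite -[RHS](card_perm_lt s) 1?ltnW //.
by apply: eq_card => y; rewrite !inE std_lt lt_s.
Qed.

End Standardization.

(** * Composition of two shuffles by labels *)

Section ShuffleLaw.
Variables (R : realFieldType) (n : nat).

Definition shuffle_law d (T : finOrderType d) (q : T -> R) (s : 'S_n) : R :=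
  \sum_(K : {ffun 'I_n -> T} | std K == s) \prod_(x < n) q (K x).

(** The second shuffle sees card [x] at position [std K1 x]. Its label comes first in the pair
    because the last sort dominates; its ties are broken by the current positions, that is, by [K1]
    and then by [x]. *)
Lemma std_mul d1 d2 d3 (T1 : finOrderType d1) (T2 : finOrderType d2)
    (K1 : {ffun 'I_n -> T1}) (K2 : {ffun 'I_n -> T2}) :
  (std K1 * std K2)%g =
  std [ffun x => (K2 (std K1 x), K1 x) : T2 *lexi[d3] T1].
Proof.
apply/esym/eqP/std_eqP => x y; rewrite !permM std_lt /lexlt !ffunE std_lt /lexlt.
rewrite ltxi_pair xpair_eqE.
by case: (ltgtP (K2 _) (K2 _)) => //= _; case: (ltgtP (K1 _) (K1 _)).
Qed.

Lemma shuffle_law_mul d1 d2 d3 (T1 : finOrderType d1) (T2 : finOrderType d2)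
    (q1 : T1 -> R) (q2 : T2 -> R) (s : 'S_n) :
  \sum_(t : 'S_n) shuffle_law q1 t * shuffle_law q2 (t^-1 * s)%g =
  shuffle_law (fun u : T2 *lexi[d3] T1 => q2 u.1 * q1 u.2) s.
Proof.
pose F (K1 : {ffun 'I_n -> T1}) (K2 : {ffun 'I_n -> T2}) :=
  (\prod_(x < n) q1 (K1 x)) * \prod_(x < n) q2 (K2 x).
transitivity (\sum_(K1 : {ffun 'I_n -> T1})
    \sum_(K2 : {ffun 'I_n -> T2} | (std K1 * std K2)%g == s) F K1 K2).
  rewrite [RHS](partition_big (@std _ T1 n) xpredT) //=; apply: eq_bigr => t _.
  rewrite big_distrl /=; apply: eq_bigr => K1 /eqP stdK1.
  rewrite big_distrr /=; apply: eq_bigl => K2.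
  by rewrite stdK1 -(inj_eq (mulgI t)) mulKVg.
transitivity (\sum_(K1 : {ffun 'I_n -> T1}) \sum_(K2 : {ffun 'I_n -> T2})
    if std [ffun x => (K2 x, K1 x) : T2 *lexi[d3] T1] == s then F K1 K2 else 0).
  apply: eq_bigr => K1 _; rewrite big_mkcond /=.
  (* For fixed [K1], reading [K2] along [std K1] permutes the words [K2] and keeps their weight;
     afterwards both labels are indexed by the original card. *)
  pose shift (t : 'S_n) (K : {ffun 'I_n -> T2}) := [ffun x => K (t x)].
  have shift_bij : bijective (shift (std K1)).
    by exists (shift (std K1)^-1%g) => K; apply/ffunP => x; rewrite !ffunE ?permK ?permKV.
  rewrite [RHS](reindex _ (onW_bij _ shift_bij)) /=; apply: eq_bigr => K2 _.
  rewrite (std_mul d3) /F.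
  have -> : \prod_(x < n) q2 (shift (std K1) K2 x) = \prod_(x < n) q2 (K2 x).
    rewrite [RHS](reindex_inj (@perm_inj _ (std K1))) /=.
    by apply: eq_bigr => x _; rewrite ffunE.
  by under [in RHS]eq_ffun do rewrite ffunE.
rewrite pair_bigA /shuffle_law /= [RHS]big_mkcond /=.
pose merge (u : {ffun 'I_n -> T1} * {ffun 'I_n -> T2}) :=
  [ffun x => (u.2 x, u.1 x) : T2 *lexi[d3] T1].
have merge_bij : bijective merge.
  exists (fun K : {ffun 'I_n -> T2 *lexi[d3] T1} =>
    ([ffun x => (K x).2] : {ffun 'I_n -> T1}, [ffun x => (K x).1] : {ffun 'I_n -> T2}))
    => [[K1 K2]|K].
    by congr (_, _); apply/ffunP => x; rewrite !ffunE.
  by apply/ffunP => x; rewrite !ffunE; case: (K x).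
rewrite [RHS](reindex _ (onW_bij _ merge_bij)) /=; apply: eq_bigr => -[K1 K2] _ /=.
case: ifP => // _; rewrite /F mulrC -big_split /=.
by apply: eq_bigr => x _; rewrite ffunE.
Qed.

End ShuffleLaw.

(** * Distance to uniform and the collision bound *)

Section Distance.
Variables (R : realFieldType) (n : nat) (d : Order.disp_t) (T : finOrderType d).
Variable q : T -> R.
Hypotheses (q_ge0 : forall t, 0 <= q t) (q_sum1 : \sum_t q t = 1).
Implicit Types (K : {ffun 'I_n -> T}) (x y : 'I_n) (s t : 'S_n).

Let weight K : R := \prod_(x < n) q (K x).

Lemma weight_ge0 K : 0 <= weight K.
Proof. exact: prodr_ge0. Qed.

Lemma weight_sum1 : \sum_K weight K = 1.
Proof. by rewrite -(bigA_distr_bigA (fun _ => q)) big1. Qed.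

Definition inj_law s : R := \sum_(K : {ffun 'I_n -> T} | (std K == s) && injectiveb K) weight K.
Definition collision_prob : R := \sum_(K : {ffun 'I_n -> T} | ~~ injectiveb K) weight K.

(** Precomposing [K] with [s] keeps the weight and turns [std K] into [s * std K]. Injectivity
    matters here: a tie would be broken by the card numbers, which [s] changes. *)
Lemma inj_law_const s : inj_law s = inj_law 1%g.
Proof.
pose shift K : {ffun 'I_n -> T} := [ffun x => K (s x)].
have shift_bij : bijective shift.
  exists (fun K : {ffun 'I_n -> T} => [ffun x => K ((s^-1)%g x)]) => K; apply/ffunP => x;
  by rewrite !ffunE ?permK ?permKV.
have shift_inj K : injectiveb (shift K) = injectiveb K.
  apply/injectiveP/injectiveP => injK x y.
    move=> eqK; apply: (can_inj (permKV s)); apply: injK.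
    by rewrite !ffunE !permKV.
  by rewrite !ffunE => /injK /perm_inj.
rewrite /inj_law (reindex _ (onW_bij _ shift_bij)) /=.
apply: eq_big => [K|K _]; last first.
  rewrite /weight [RHS](reindex_inj (@perm_inj _ s)) /=.
  by apply: eq_bigr => x _; rewrite ffunE.
rewrite shift_inj; case: (boolP (injectiveb K)); rewrite ?andbF // => /injectiveP injK.
rewrite !andbT.
have -> : std (shift K) = (s * std K)%g.
  apply/eqP/std_eqP => x y; rewrite !permM std_lt /lexlt !ffunE.
  case/orP => [-> //|/andP[/eqP/injK/perm_inj ->]].
  by rewrite ltnn.
by rewrite -[RHS](inj_eq (mulgI s)) mulg1.
Qed.

Lemma inj_law_sum : \sum_s inj_law s = 1 - collision_prob.
Proof.
apply/eqP; rewrite eq_sym subr_eq -weight_sum1 /collision_prob.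
rewrite (bigID (fun K : {ffun 'I_n -> T} => injectiveb K)) /=; apply/eqP; congr (_ + _).
rewrite (partition_big (@std _ T n) xpredT) //=.
by apply: eq_bigr => s _; apply: eq_bigl => K; rewrite andbC.
Qed.

(** With [c] the collision probability, the injective words contribute [(1 - c) / n!] at each [s],
    so the law minus uniform is [col_law s - c / n!]. Both terms have total mass [c], and the factor
    one half absorbs the resulting [2 * c]. *)
Lemma tv_shuffle_law_unif :
  tv_dist (shuffle_law q) (unif_on R [set: 'S_n]) <= collision_prob.
Proof.
have fact_neq0 : (n`!)%:R != 0 :> R by rewrite pnatr_eq0 -lt0n fact_gt0.
have col_ge0 : 0 <= collision_prob by apply: sumr_ge0 => K _; apply: weight_ge0.
have inj_lawE s : inj_law s = (1 - collision_prob) / (n`!)%:R.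
  apply/(canRL (mulfK fact_neq0)); rewrite -inj_law_sum.
  rewrite (eq_bigr (fun=> inj_law s)) => [|t _]; last first.
    by rewrite inj_law_const [RHS]inj_law_const.
  by rewrite sumr_const card_Sn mulr_natr.
pose col_law s := \sum_(K : {ffun 'I_n -> T} | (std K == s) && ~~ injectiveb K) weight K.
have col_law_sum : \sum_s col_law s = collision_prob.
  rewrite /collision_prob (partition_big (@std _ T n) xpredT) //=.
  by apply: eq_bigr => s _; apply: eq_bigl => K; rewrite andbC.
(* Write [c + c] as the sum over [s] of [c / n! + col_law s], to compare termwise. *)
rewrite /tv_dist mulrC ler_pdivrMr // mulr_natr mulr2n -{1}[collision_prob](divfK fact_neq0) -{2}col_law_sum.
rewrite mulr_natr -card_Sn -sumr_const -big_split /=.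
apply: ler_sum => s _.
have -> : shuffle_law q s - unif_on R [set: 'S_n] s =
          - (collision_prob / (n`!)%:R) + col_law s.
  rewrite /shuffle_law (bigID (fun K : {ffun 'I_n -> T} => injectiveb K)) /= -/(inj_law s) -/(col_law s).
  rewrite inj_lawE /unif_on inE cardsT card_Sn mulrBl mul1r.
  by rewrite addrAC [_^-1 + _]addrC addrK.
rewrite (le_trans (ler_normD _ _)) // normrN !ger0_norm ?card_Sn //.
  by apply: sumr_ge0 => K _; apply: weight_ge0.
by rewrite divr_ge0.
Qed.

(** For a fixed common letter [t], the words form a product family: coordinates [x] and [y] are
    forced to be [t], the others are free. The sum factors, each free coordinate contributing
    [1]. *)
Lemma pair_collision x y : x != y ->
  \sum_(K : {ffun 'I_n -> T} | K x == K y) weight K = \sum_t q t ^+ 2.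
Proof.
move=> neq_xy; rewrite (partition_big (fun K : {ffun 'I_n -> T} => K x) xpredT) //=.
apply: eq_bigr => t _.
pose Q z u := (z \in [set x; y]) ==> (u == t).
transitivity (\sum_(K : {ffun 'I_n -> T} | K \in family Q) weight K).
  apply: eq_bigl => K; apply/idP/familyP => [/andP[/eqP eqK /eqP Kx] z|famK].
    by apply/implyP; rewrite !inE => /orP[]/eqP ->; rewrite -?eqK Kx.
  have famE z : z \in [set x; y] -> K z = t.
    by move=> z_xy; have := famK z; rewrite unfold_in /Q z_xy => /eqP.
  by rewrite !famE ?inE ?eqxx ?orbT.
rewrite -(bigA_distr_big_dep _ (fun _ u => q u)) /= (bigD1 x) // (bigD1 y) 1?eq_sym //=.
rewrite [X in _ * (_ * X)]big1 ?mulr1 => [|z /andP[zx zy]].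
  rewrite (eq_bigl (pred1 t)) => [|u]; last by rewrite /Q !inE eqxx.
  rewrite big_pred1_eq (eq_bigl (pred1 t)) => [|u]; last by rewrite /Q !inE eqxx orbT.
  by rewrite big_pred1_eq expr2.
by rewrite -q_sum1; apply: eq_bigl => u; rewrite /Q !inE (negPf zx) (negPf zy).
Qed.

Lemma collision_prob_le : collision_prob <= 'C(n, 2)%:R * \sum_t q t ^+ 2.
Proof.
pose Q : R := \sum_t q t ^+ 2.
have -> : 'C(n, 2)%:R * Q = \sum_(y < n) \sum_(x < n | (x < y)%N) Q.
  rewrite -bin2_sum big_mkord natr_sum mulr_suml; apply: eq_bigr => y _.
  rewrite sumr_const -[RHS]mulr_natl; congr (_%:R * _).
  rewrite -[LHS](card_perm_lt 1 (ltnW (ltn_ord y))).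
  by apply: eq_card => x; rewrite !inE perm1.
under eq_bigr => y _ do under eq_bigr => x lt_xy do
  rewrite /Q -(@pair_collision x y) ?neq_ltn ?lt_xy //.
under eq_bigr => y _ do rewrite (exchange_big_dep xpredT) //=.
(* Summing over words first, each [K] is counted once per colliding pair, so it remains to find one
   such pair for every non-injective [K]. *)
rewrite exchange_big /= /collision_prob big_mkcond /=.
apply: ler_sum => K _; case: ifPn => [/injectivePn|_]; last first.
  by apply: sumr_ge0 => y _; apply: sumr_ge0 => x _; apply: weight_ge0.
have w_ge0 := weight_ge0 K.
suff main x y : (x < y)%N -> K x = K y -> weight K <=
    \sum_(y < n) \sum_(x < n | (x < y)%N && (K x == K y)) weight K.
  case=> x [y neq_xy eqK]; have := neq_xy; rewrite -val_eqE neq_ltn.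
  by case/orP => lt_xy; [apply: (main x y)|apply: (main y x)].
move=> lt_xy eqK; rewrite (bigD1 y) //= (bigD1 x) ?lt_xy ?eqK //=.
rewrite -addrA lerDl addr_ge0 //; apply: sumr_ge0 => // z _.
by apply: sumr_ge0.
Qed.

End Distance.

(** * Splitting off the first coordinate of a finite function *)

Section Fcons.
Variables (T : finType) (n : nat).

Definition fcons (t : T) (K : {ffun 'I_n -> T}) : {ffun 'I_n.+1 -> T} :=
  [ffun i => oapp K t (unlift ord0 i)].

Lemma fcons0 t K : fcons t K ord0 = t.
Proof. by rewrite ffunE unlift_none. Qed.

Lemma fconsS t K i : fcons t K (lift ord0 i) = K i.
Proof. by rewrite ffunE liftK. Qed.

Lemma big_fcons (V : Type) (idx : V) (op : Monoid.com_law idx)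
    (F : {ffun 'I_n.+1 -> T} -> V) :
  \big[op/idx]_K F K = \big[op/idx]_t \big[op/idx]_K F (fcons t K).
Proof.
rewrite pair_bigA; apply: (reindex (fun u => fcons u.1 u.2)); apply: onW_bij.
exists (fun K : {ffun 'I_n.+1 -> T} =>
    (K ord0, [ffun i => K (lift ord0 i)] : {ffun 'I_n -> T})) => [[t K]|K] /=.
  by rewrite fcons0; congr (_, _); apply/ffunP => i; rewrite ffunE fconsS.
apply/ffunP => i; case: (unliftP ord0 i) => [j ->|->]; last by rewrite fcons0.
by rewrite fconsS ffunE.
Qed.

End Fcons.

(** * Convolution powers as single shuffles *)

Section ConvPow.
Variables (R : realFieldType).

Lemma conv_pow0 (gT : finGroupType) (P : gT -> R) x :
  conv_pow P 0 x = (x == 1%g)%:R.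
Proof.
rewrite /conv_pow; under eq_bigl do rewrite big_ord0 eq_sym.
under eq_bigr do rewrite big_ord0.
case: eqP => _; last by rewrite big_pred0.
by rewrite sumr_const card_ffun card_ord expn0.
Qed.

Lemma conv_powS (gT : finGroupType) (P : gT -> R) k x :
  conv_pow P k.+1 x = \sum_y P y * conv_pow P k (y^-1 * x)%g.
Proof.
rewrite /conv_pow big_mkcond big_fcons /=; apply: eq_bigr => y _.
rewrite mulr_sumr [RHS]big_mkcond /=; apply: eq_bigr => s _.
have fconsE (i : 'I_k) : fcons y s (lift ord0 i) = s i by rewrite fconsS.
rewrite !big_ord_recl fcons0 (eq_bigr s) => [|i _]; last by rewrite fconsE.
rewrite -[in RHS](inj_eq (mulgI y)) mulKVg; case: ifP => // _.
by congr (_ * _); apply: eq_bigr => i _; rewrite fconsE.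
Qed.

(** The label type is existential because each further factor enlarges it to a lexicographic
    product, on which the sum of squares is multiplicative. *)
Lemma conv_pow_shuffle_law n d (T : finOrderType d) (q : T -> R) (P : 'S_n -> R) :
    (forall t, 0 <= q t) -> \sum_t q t = 1 -> P =1 shuffle_law q -> forall k,
  exists d' (T' : finOrderType d') (q' : T' -> R),
    [/\ forall t, 0 <= q' t, \sum_t q' t = 1,
        \sum_t q' t ^+ 2 = (\sum_t q t ^+ 2) ^+ k
      & conv_pow P k =1 shuffle_law q'].
Proof.
move=> q_ge0 q_sum1 PE; elim=> [|k [d' [T' [q' [q'_ge0 q'_sum1 q'_sq convE]]]]].
  (* The empty product is the shuffle with a single label: all cards tie, and the stable sort leaves
     them in place. *)
  exists _, 'I_1, (fun=> 1); split=> //; rewrite ?big_ord1 ?expr1n //.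
  move=> s; rewrite conv_pow0 /shuffle_law.
  under eq_bigr do rewrite big1 //.
  have std1 (K : {ffun 'I_n -> 'I_1}) : std K = 1%g.
    by apply/eqP/std_eqP => x y; rewrite /lexlt !ord1 ltxx eqxx !perm1.
  under eq_bigl do rewrite std1 eq_sym.
  case: eqP => _; last by rewrite big_pred0.
  by rewrite sumr_const card_ffun card_ord exp1n.
exists _, (T' *lexi[d] T)%type, (fun u => q' u.1 * q u.2); split.
- by move=> u; apply: mulr_ge0.
- rewrite -(pair_bigA _ (fun t' t => q' t' * q t)) /= -[RHS](mul1r 1).
  by rewrite -{1}q'_sum1 -q_sum1 big_distrlr.
- under eq_bigr do rewrite exprMn.
  rewrite -(pair_bigA _ (fun t' t => q' t' ^+ 2 * q t ^+ 2)) /= exprSr -q'_sq.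
  by rewrite big_distrlr.
move=> s; rewrite conv_powS -shuffle_law_mul.
by apply: eq_bigr => t _; rewrite PE convE.
Qed.

End ConvPow.

(** * Counting words with prescribed letter multiplicities *)

(** Induction on the first letter [t]: the rest of the word uses [t] once less, and
    [b t * (b t - 1)! = (b t)!]. Summing the factors [b t] over [t] gives [n.+1]. *)
Lemma card_words (T : finType) (n : nat) (b : T -> nat) : (\sum_t b t)%N = n ->
  (#|[set K : {ffun 'I_n -> T} | [forall t, #|[set x | K x == t]| == b t]]|
   * \prod_t (b t)`! = n`!)%N.
Proof.
elim: n b => [|n IHn] b sum_b.
  have b0 t : b t = 0%N by apply/eqP; rewrite -leqn0 -sum_b (bigD1 t) //= leq_addr.
  rewrite big1 ?muln1 => [|t _]; last by rewrite b0.
  rewrite -[RHS](expn0 #|T|) -[in RHS](card_ord 0) -card_ffun -cardsT.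
  apply: eq_card => K; rewrite !inE; apply/forallP => t; rewrite b0.
  by rewrite cards_eq0; apply/eqP/setP; case.
rewrite -sum1dep_card big_mkcond big_fcons /= big_distrl factS -[in RHS]sum_b big_distrl /=.
apply: eq_bigr => t _; rewrite -big_mkcond sum1dep_card.
have count_fcons (K : {ffun 'I_n -> T}) t' :
    #|[set x | fcons t K x == t']| = ((t == t') + #|[set x | K x == t']|)%N.
  rewrite -!sum1dep_card big_mkcond big_ord_recl fcons0 [in RHS]big_mkcond; congr (_ + _)%N.
  by apply: eq_bigr => i _; rewrite fconsS.
(* No word starts with a letter of multiplicity [0]; setting this case aside keeps the truncated
   subtraction in [b'] exact. *)
have [bt0|bt_gt0] := posnP (b t).
  rewrite bt0 mul0n; apply/eqP; rewrite muln_eq0 cards_eq0; apply/orP; left.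
  apply/eqP/setP => K; rewrite !inE; apply/negbTE/forallPn; exists t.
  by rewrite count_fcons eqxx bt0.
pose b' t' := (b t' - (t == t'))%N.
have b'E t' : b t' = ((t == t') + b' t')%N.
  by rewrite /b' subnKC //; case: eqP => // <-.
have sum_b' : (\sum_t' b' t')%N = n.
  apply/eqP; rewrite -eqSS -sum_b (eq_bigr _ (fun t' _ => b'E t')) big_split /=.
  rewrite -add1n eqn_add2r (bigD1 t) //= eqxx big1 ?addn0 // => t' /negPf.
  by rewrite eq_sym => ->.
rewrite -(IHn _ sum_b') mulnCA; congr (_ * _)%N.
  apply: eq_card => K; rewrite !inE; apply: eq_forallb => t'.
  by rewrite count_fcons b'E eqn_add2l.
rewrite (bigD1 t) //= [in RHS](bigD1 t) //= mulnA; congr (_ * _)%N.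
  by rewrite [b t]b'E eqxx add1n factS.
by apply: eq_bigr => t' /negPf; rewrite b'E eq_sym => ->.
Qed.

(** * Bijection between words and shuffles with given pile sizes *)

Section Piles.
Variables (n a : nat).
Implicit Types (K : {ffun 'I_n -> 'I_a.+1}) (b c : {ffun 'I_a.+1 -> 'I_n.+1}).
Implicit Types (s : 'S_n) (x y : 'I_n) (j : 'I_a.+1).

Definition content K : {ffun 'I_a.+1 -> 'I_n.+1} :=
  [ffun j => inord #|[set x | K x == j]|].

Lemma contentE K j : content K j = #|[set x | K x == j]| :> nat.
Proof. by rewrite ffunE inordK // ltnS -[n in (_ <= n)%N]card_ord max_card. Qed.

Definition psum b j : nat := (\sum_(i < a.+1 | (i <= j)%N) b i)%N.

Lemma leq_psum b j j' : (j <= j')%N -> (psum b j <= psum b j')%N.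
Proof.
move=> le_jj'; rewrite /psum [leqRHS](bigID (fun i : 'I_a.+1 => (i <= j)%N)) /=.
rewrite [X in (_ <= X + _)%N](eq_bigl (fun i : 'I_a.+1 => (i <= j)%N)) ?leq_addr // => i.
by case: (leqP i j) => [/leq_trans->//|_]; rewrite andbF.
Qed.

Lemma psum_max b : b \in pile_sizes n a.+1 -> psum b ord_max = n.
Proof.
rewrite inE => /eqP <-; apply: eq_bigl => i.
by rewrite -ltnS ltn_ord.
Qed.

Lemma psum_inj b c : psum b =1 psum c -> b = c.
Proof.
move=> eq_bc; apply/ffunP.
suff main m (j : 'I_a.+1) : (j < m)%N -> b j = c j by move=> j; apply: (main j.+1).
elim: m j => // m IHm j; rewrite ltnS => le_jm; apply: val_inj.
have := eq_bc j; rewrite /psum (bigD1 j) //= [RHS](bigD1 j) //=.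
rewrite (eq_bigr (fun i => val (c i))) => [/addIn //|i /andP[le_ij neq_ij]].
rewrite IHm //; apply: leq_trans le_jm.
by rewrite ltn_neqAle le_ij andbT.
Qed.

Lemma psum_content K j : psum (content K) j = #|[set x | (K x <= j)%N]|.
Proof.
rewrite -sum1dep_card (partition_big K (fun i : 'I_a.+1 => (i <= j)%N)) //=.
apply: eq_bigr => i le_ij; rewrite contentE -sum1dep_card.
by apply: eq_bigl => x; case: eqP => [->|]; rewrite ?le_ij ?andbF.
Qed.

Lemma content_pile_sizes K : content K \in pile_sizes n a.+1.
Proof.
rewrite inE; have -> : (\sum_(i < a.+1) content K i)%N = psum (content K) ord_max.
  by apply: eq_bigl => i; rewrite -ltnS ltn_ord.
rewrite psum_content -[X in _ == X]card_ord -cardsT; apply/eqP.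
by apply: eq_card => x; rewrite !inE -ltnS ltn_ord.
Qed.

(** The cards labelled at most [j] fill exactly the first [psum (content K) j] positions. Hence
    [content K] and [std K] together determine [K]. *)
Lemma std_content K j x : (K x <= j)%N = (std K x < psum (content K) j)%N.
Proof.
rewrite psum_content; have [le_xj|lt_jx] := leqP (K x) j; apply/esym.
  apply: (@leq_ltn_trans #|[set y | (std K y < std K x)%N]|).
    by rewrite card_perm_lt ?leqnn // ltnW.
    apply/proper_card/properP; split; last by exists x; rewrite !inE ?ltnn.
  apply/subsetP => y; rewrite !inE std_lt => /orP[lt_yx|/andP[/eqP -> _] //].
  exact: leq_trans (ltnW lt_yx) le_xj.
apply/negbTE; rewrite -leqNgt.
apply: (@leq_trans #|[set y | (std K y < std K x)%N]|); last first.
  by rewrite card_perm_lt ?leqnn // ltnW.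
apply/subset_leq_card/subsetP => y; rewrite !inE std_lt => le_yj.
by rewrite /lexlt [(_ < _)%O](leq_ltn_trans le_yj lt_jx).
Qed.

(** At a descent of the inverse, neighbouring positions hold cards [x], [y] with [y < x]. A stable
    sort allows this only if [K x < K y], so the cut is where the cards labelled at most [K x]
    end. *)
Lemma std_shuffles K : std K \in shuffles (content K).
Proof.
rewrite inE; apply/subsetP => i; rewrite !inE => /orP[/andP[n_gt0 /eqP i_n]|].
  (* The conventional descent at [n] is the last partial sum. *)
  apply/existsP; exists ord_max.
  by rewrite i_n -/(psum _ _) psum_max ?content_pile_sizes.
case/existsP => p /existsP[r /and3P[/eqP p_i /eqP r_i lt_rp]].
set x := (_ p) in lt_rp; set y := (_ r) in lt_rp.
have px : p = std K x by rewrite permKV.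
have ry : r = std K y by rewrite permKV.
have : lexlt K x y by rewrite -std_lt -px -ry p_i r_i.
case/orP => [lt_xy|/andP[_ lt_xy]]; last by rewrite ltnNge (ltnW lt_rp) in lt_xy.
apply/existsP; exists (K x); rewrite -/(psum _ _) eqn_leq.
have -> : (i <= psum (content K) (K x))%N by rewrite -p_i px -std_content.
by rewrite -r_i ry leqNgt -std_content -ltnNge.
Qed.

(** A descent at [i] compares the entries with zero-based indices [i - 1] and [i], hence the
    half-open range [p < i <= r]. *)
Lemma increasing_run s (p r : 'I_n) : (p < r)%N ->
    (forall i : 'I_n.+1, i \in descent_set s -> ~~ (p < i <= r)%N) ->
  (s p < s r)%N.
Proof.
case: r => m m_n /=; elim: m m_n => // m IHm m_n lt_pm no_desc.
have m_n' := ltnW m_n.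
have lt_s : (s (Ordinal m_n') < s (Ordinal m_n))%N.
  rewrite ltn_neqAle (inj_eq val_inj) (inj_eq perm_inj) -val_eqE /= neq_ltn leqnn /=.
  rewrite leqNgt; apply/negP => desc.
  have := no_desc (Ordinal (leqW m_n : m.+1 < n.+1)%N).
  rewrite lt_pm leqnn => /(_ _)/negP; apply => //.
  rewrite inE; apply/orP; right; apply/existsP; exists (Ordinal m_n').
  by apply/existsP; exists (Ordinal m_n); rewrite /= !eqxx.
move: lt_pm; rewrite ltnS leq_eqVlt => /orP[/eqP eq_pm|lt_pm].
  by rewrite (_ : p = Ordinal m_n') //; apply: val_inj.
apply: ltn_trans lt_s; apply: IHm => // i /no_desc.
by apply: contra => /andP[-> /leqW].
Qed.

Lemma shuffles_std b s : b \in pile_sizes n a.+1 -> s \in shuffles b ->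
  exists2 K, content K = b & std K = s.
Proof.
move=> b_n; rewrite inE => /subsetP s_b.
(* The label of [x] is the pile containing position [s x]: the first pile whose end lies beyond
   it. *)
pose K : {ffun 'I_n -> 'I_a.+1} :=
  [ffun x => [arg min_(j < ord_max | (s x < psum b j)%N) (j : nat)]%N].
have KP j x : (K x <= j)%N = (s x < psum b j)%N.
  rewrite ffunE; case: arg_minnP => [|i lt_i min_i]; first by rewrite psum_max.
  apply/idP/idP => [le_ij|/min_i //].
  exact: leq_trans lt_i (leq_psum _ le_ij).
have psum_le j : (psum b j <= n)%N.
  by rewrite -[leqRHS](psum_max b_n) leq_psum // -ltnS ltn_ord.
exists K.
  apply: psum_inj => j; rewrite psum_content -(card_perm_lt s (psum_le j)).
  by apply: eq_card => x; rewrite !inE KP.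
apply/eqP/std_eqP => x y /orP[lt_xy|/andP[/eqP eq_xy lt_xy]].
  apply: (@leq_trans (psum b (K x))); first by rewrite -KP.
  by rewrite leqNgt -KP -ltnNge.
rewrite ltnNge leq_eqVlt (inj_eq val_inj) (inj_eq perm_inj) -val_eqE /=.
rewrite gtn_eqF //=; apply/negP => lt_yx.
(* Two cards with the same label have no cut between their positions, so [s^-1] increases there. *)
suff: ((s^-1)%g (s y) < (s^-1)%g (s x))%N by rewrite !permK ltnNge (ltnW lt_xy).
apply: increasing_run => // i /s_b; rewrite inE => /existsP[j /eqP ->].
rewrite -/(psum _ _) -KP -eq_xy; apply/negP => /andP[le_xj].
by rewrite leqNgt -KP le_xj.
Qed.

Lemma std_content_inj K K' : content K = content K' -> std K = std K' -> K = K'.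
Proof.
move=> eq_c eq_s; have eq_le j x : (K x <= j)%N = (K' x <= j)%N.
  by rewrite !std_content eq_c eq_s.
by apply/ffunP => x; apply/val_inj/eqP; rewrite eqn_leq eq_le leqnn /= -eq_le.
Qed.

(** Makes the multinomial coefficient the number of admissible permutations, via the bijection [std]
    from words of content [b]. *)
Lemma card_shuffles b : b \in pile_sizes n a.+1 ->
  (#|shuffles b| * \prod_j (b j)`! = n`!)%N.
Proof.
move=> b_n; rewrite -(@card_words _ n (fun j => b j)); last by move: b_n; rewrite inE => /eqP.
congr (_ * _)%N.
pose words := [set K | content K == b].
have -> : shuffles b = (@std _ 'I_a.+1 n) @: words.
  apply/setP => s; apply/idP/imsetP => [/(shuffles_std b_n)[K contK <-]|[K]].
    by exists K; rewrite ?inE ?contK.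
  by rewrite inE => /eqP <- ->; apply: std_shuffles.
rewrite card_in_imset => [|K K']; last first.
  by rewrite !inE => /eqP <- /eqP /esym; apply: std_content_inj.
apply: eq_card => K; rewrite !inE; apply/eqP/forallP => [<- j|eq_b].
  by rewrite contentE.
by apply/ffunP => j; apply/val_inj/eqP; rewrite /= contentE; apply: eq_b.
Qed.

(** Split the words by content. For each [b] the multinomial cancels the uniform factor, and at most
    one word of content [b] standardizes to [s], with weight [\prod_j p j ^+ b j]. *)
Lemma biased_shuffle_law (R : realFieldType) (p : 'I_a.+1 -> R) :
  biased_shuffle p =1 @shuffle_law R n _ _ p.
Proof.
move=> s; rewrite /shuffle_law.
rewrite (partition_big content (fun b => b \in pile_sizes n a.+1)) /= => [|K _];
  last exact: content_pile_sizes.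
apply: eq_bigr => b b_n.
have card_neq0 : #|shuffles b|%:R != 0 :> R.
  by rewrite pnatr_eq0; apply/eqP => card0; have := card_shuffles b_n;
    rewrite card0 mul0n => /esym/eqP; rewrite eqn0Ngt fact_gt0.
have fact_neq0 : \prod_(j < a.+1) ((b j)`!)%:R != 0 :> R.
  by apply/prodf_neq0 => j _; rewrite pnatr_eq0 -lt0n fact_gt0.
have -> : multinomial R b = #|shuffles b|%:R.
  by rewrite /multinomial -(card_shuffles b_n) natrM natr_prod mulfK.
rewrite /unif_on; case: ifPn => [s_b|s_nb]; last first.
  rewrite mulr0 big_pred0 // => K; apply/negP => /andP[/eqP stdK /eqP contK].
  by rewrite -stdK -contK std_shuffles in s_nb.
have [K contK stdK] := shuffles_std b_n s_b.
rewrite (big_pred1 K) => [|K']; last first.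
  rewrite -stdK -contK; apply/andP/eqP => [[/eqP ? /eqP ?]|-> //].
  exact: std_content_inj.
rewrite mulrAC mulfV // mul1r (partition_big K xpredT) //=; apply: eq_bigr => j _.
rewrite (eq_bigr (fun=> p j)) => [|x /eqP -> //].
by rewrite prodr_const -contK contentE cardsE.
Qed.

End Piles.

Theorem theorem1 (R : realFieldType) (n a k : nat) (p : 'I_a -> R)
    (n_ge1 : (1 <= n)%N) (a_ge1 : (1 <= a)%N) (k_ge1 : (1 <= k)%N)
    (p_ge0 : forall i, 0 <= p i) (p_sum1 : \sum_(i < a) p i = 1) :
  tv_dist (conv_pow (@biased_shuffle R n a p) k) (unif_on R [set: 'S_n])
    <= 'C(n, 2)%:R * (\sum_(i < a) p i ^+ 2) ^+ k.
Proof.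
(* The pile lemmas are stated for [a.+1] piles, so that a last pile [ord_max] exists. *)
case: a a_ge1 p p_ge0 p_sum1 => // a _ p p_ge0 p_sum1.
have [d [T [q [q_ge0 q_sum1 q_sq convE]]]] :=
  @conv_pow_shuffle_law R n _ _ p _ p_ge0 p_sum1 (@biased_shuffle_law n a R p) k.
rewrite -q_sq (le_trans _ (collision_prob_le n q_ge0 q_sum1)) //.
rewrite (le_trans _ (tv_shuffle_law_unif n q_ge0 q_sum1)) //.
by rewrite /tv_dist; under eq_bigr do rewrite convE.
Qed.
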